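(* For every ground ES $\mathcal{E}$ and every reduced ground TRS $\mathcal{R}$ that is equivalent to $\mathcal{E}$ (i.e. $\leftrightarrow_{\mathcal{E}}^*\,=\,\leftrightarrow_{\mathcal{R}}^*$) there exist a reduction order $>$ and a $\mathsf{KB_g}$ derivation (with respect to $>$) $(\mathcal{E},\varnothing)\vdash_{\mathsf g}\cdots\vdash_{\mathsf g}(\varnothing,\mathcal{R})$.
   Context: An ES is a set of pairs of terms $s\approx t$ and a TRS a set of rules $\ell\to r$; they are ground if all their terms are ground (variable-free). For a set $X$ of pairs of terms, $\to_X$ is its closure under contexts and substitutions, $\leftrightarrow_X^*$ the induced conversion relation, and $\mathrm{NF}(X)$ the set of $\to_X$-normal forms. A reduction order is a well-founded strict order on terms closed under contexts and substitutions. A TRS $\mathcal{R}$ is reduced if for every $\ell\to r\in\mathcal{R}$ we have $\ell\in\mathrm{NF}(\mathcal{R}\setminus\{\ell\to r\})$ and $r\in\mathrm{NF}(\mathcal{R})$. Inference system $\mathsf{KB_g}$ of ground completion (for a fixed reduction order $>$; $\uplus$ is disjoint union): $(\mathcal{E},\mathcal{R})\vdash_{\mathsf g}(\mathcal{E}',\mathcal{R}')$ if it is an instance of one of - orient: $(\mathcal{E}\uplus\{s\approx t\},\mathcal{R})\vdash(\mathcal{E},\mathcal{R}\cup\{s\to t\})$ if $s>t$, and $(\mathcal{E}\uplus\{s\approx t\},\mathcal{R})\vdash(\mathcal{E},\mathcal{R}\cup\{t\to s\})$ if $t>s$; - delete: $(\mathcal{E}\uplus\{s\approx s\},\mathcal{R})\vdash(\mathcal{E},\mathcal{R})$;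 - compose: $(\mathcal{E},\mathcal{R}\uplus\{s\to t\})\vdash(\mathcal{E},\mathcal{R}\cup\{s\to u\})$ if $t\to_{\mathcal{R}}u$; - simplify: $(\mathcal{E}\uplus\{s\approx t\},\mathcal{R})\vdash(\mathcal{E}\cup\{u\approx t\},\mathcal{R})$ if $s\to_{\mathcal{R}}u$, and $(\mathcal{E}\uplus\{s\approx t\},\mathcal{R})\vdash(\mathcal{E}\cup\{s\approx u\},\mathcal{R})$ if $t\to_{\mathcal{R}}u$; - collapse: $(\mathcal{E},\mathcal{R}\uplus\{t\to s\})\vdash(\mathcal{E}\cup\{u\approx s\},\mathcal{R})$ if $t\to_{\mathcal{R}}u$.
   Formalization: The ground ES is assumed finite: each inference step removes at most one equation, so from an infinite ES no finite derivation can reach the empty set of equations (e.g. all fⁿ(a) ≈ fⁿ(a) with the empty TRS). *)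

(* Defs.v *)
From mathcomp Require Import all_boot.
From mathcomp Require Import boolp classical_sets cardinality.
From Stdlib Require Import Relations.

Set Implicit Arguments.
Unset Strict Implicit.
Unset Printing Implicit Defensive.

Local Open Scope classical_set_scope.

Record signature := Signature { sym :> Type; arity : sym -> nat }.

Section Rewriting.
Variables (F : signature) (V : Type).

Inductive term : Type :=
| Var (x : V)
| Fun (f : F) (ts : 'I_(arity f) -> term).

Fixpoint ground (t : term) : Prop :=
  match t with
  | Var _ => False
  | Fun f ts => forall i, ground (ts i)
  end.

Fixpoint subst (sigma : V -> term) (t : term) : term :=
  match t with
  | Var x => sigma x
  | Fun f ts => Fun (fun i => subst sigma (ts i))
  end.

(* [CFun f i ts C] is f(ts_0, ..., C, ..., ts_(n-1)) with C in position i;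
   the i-th component of ts is ignored. *)
Inductive context : Type :=
| Hole
| CFun (f : F) (i : 'I_(arity f)) (ts : 'I_(arity f) -> term) (C : context).

Fixpoint fill (C : context) (t : term) : term :=
  match C with
  | Hole => t
  | CFun f i ts D => Fun (fun j => if j == i then fill D t else ts j)
  end.

(* Used both for ESs (a pair (s, t) stands for the equation s = t, which is
   not identified with (t, s)) and for TRSs ((l, r) stands for l -> r). *)
Definition pairs : Type := set (term * term).

Definition ground_pairs (X : pairs) : Prop :=
  forall s t, X (s, t) -> ground s /\ ground t.

Definition rewrites (X : pairs) : relation term := fun s t =>
  exists (C : context) (sigma : V -> term) (l r : term),
    [/\ X (l, r), s = fill C (subst sigma l) & t = fill C (subst sigma r)].

Definition conversion (X : pairs) : relation term :=
  clos_refl_sym_trans term (rewrites X).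

Definition equivalent (X Y : pairs) : Prop :=
  forall s t, conversion X s t <-> conversion Y s t.

Definition NF (X : pairs) : set term :=
  [set s | ~ exists t, rewrites X s t].

Definition reduced (R : pairs) : Prop :=
  forall l r, R (l, r) -> NF (R `\` [set (l, r)]) l /\ NF R r.

(* [gt s t] reads s > t. *)
Record reduction_order (gt : relation term) : Prop := ReductionOrder {
  ro_irrefl : forall s, ~ gt s s;
  ro_trans : forall s t u, gt s t -> gt t u -> gt s u;
  ro_wf : well_founded (fun s t => gt t s);
  ro_ctx : forall C s t, gt s t -> gt (fill C s) (fill C t);
  ro_subst : forall sigma s t, gt s t -> gt (subst sigma s) (subst sigma t)
}.

(* The hypotheses of the form [~ E p] and [~ R p] make the unions on the left
   disjoint. *)
Inductive KBg (gt : relation term) : relation (pairs * pairs) :=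
| orient_lr (E R : pairs) s t : ~ E (s, t) -> gt s t ->
    KBg gt (E `|` [set (s, t)], R) (E, R `|` [set (s, t)])
| orient_rl (E R : pairs) s t : ~ E (s, t) -> gt t s ->
    KBg gt (E `|` [set (s, t)], R) (E, R `|` [set (t, s)])
| delete (E R : pairs) s : ~ E (s, s) ->
    KBg gt (E `|` [set (s, s)], R) (E, R)
| compose (E R : pairs) s t u : ~ R (s, t) -> rewrites R t u ->
    KBg gt (E, R `|` [set (s, t)]) (E, R `|` [set (s, u)])
| simplify_l (E R : pairs) s t u : ~ E (s, t) -> rewrites R s u ->
    KBg gt (E `|` [set (s, t)], R) (E `|` [set (u, t)], R)
| simplify_r (E R : pairs) s t u : ~ E (s, t) -> rewrites R t u ->
    KBg gt (E `|` [set (s, t)], R) (E `|` [set (s, u)], R)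
| collapse (E R : pairs) s t u : ~ R (t, s) -> rewrites R t u ->
    KBg gt (E, R `|` [set (t, s)]) (E `|` [set (u, s)], R).

Definition KBg_derivation (gt : relation term) : relation (pairs * pairs) :=
  clos_refl_trans (pairs * pairs) (KBg gt).

End Rewriting.

(* Main.v *)
(* For a reduced ground system R, let the cost of a term be the number of steps
   of its innermost R-reduction to normal form. Every left-hand side has cost 1
   and every right-hand side cost 0, and replacing a subterm by a convertible one
   changes the total cost by the difference of their costs. Comparing convertible terms by cost,
   and then by an injective monotone encoding into the natural numbers, gives a
   reduction order that contains R and is total on convertible ground terms over
   the symbols of E. Completing E with this order orients every equation and ends
   in a reduced system equivalent to R and oriented by the same order, and such
   a system must be R itself. *)
Require Import Defs.
From HB Require Import structures.
From mathcomp Require Import all_boot zify.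
From mathcomp Require Import boolp classical_sets cardinality.
From Stdlib Require Import Relations Eqdep Wellfounded.

Set Implicit Arguments.
Unset Strict Implicit.
Unset Printing Implicit Defensive.

Local Open Scope classical_set_scope.

(** * Lexicographic order on pairs of natural numbers *)

Section Lexicographic.

Definition ltlex (p q : nat * nat) : Prop :=
  p.1 < q.1 \/ p.1 = q.1 /\ p.2 < q.2.

Lemma ltlex_irrefl p : ~ ltlex p p.
Proof. by rewrite /ltlex; lia. Qed.

Lemma ltlex_trans p q r : ltlex p q -> ltlex q r -> ltlex p r.
Proof. by rewrite /ltlex; lia. Qed.

Lemma ltlex_total p q : p <> q -> ltlex p q \/ ltlex q p.
Proof.
case: p q => [a b] [c d] neq; rewrite /ltlex /=.
have [eac|] := eqVneq a c; last by lia.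
have [ebd|] := eqVneq b d; last by lia.
by rewrite eac ebd in neq.
Qed.

Lemma ltlex_wf : well_founded ltlex.
Proof.
move=> [a b]; elim/ltn_ind: a b => a IHa; elim/ltn_ind => b IHb.
by constructor=> -[c d] [/= /IHa|[/= -> /IHb]].
Qed.

End Lexicographic.

(** * Contexts, substitutions, rewriting and conversion *)

Section Terms.
Variables (F : signature) (V : Type).
Implicit Types (s t u : term F V) (C D : context F V) (X Y : pairs F V).

Fixpoint comp_ctx C D : context F V :=
  match C with
  | Hole => D
  | CFun f i ts C' => CFun i ts (comp_ctx C' D)
  end.

Lemma fill_comp C D t : fill (comp_ctx C D) t = fill C (fill D t).
Proof. by elim: C => //= f i ts C ->. Qed.

Lemma subst_fill (sigma : V -> term F V) C :
  exists D, forall t, subst sigma (fill C t) = fill D (subst sigma t).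
Proof.
elim: C => [|f i ts C [D IH]]; first by exists (Hole F V).
exists (CFun i (fun j => subst sigma (ts j)) D) => t /=; congr Fun.
by apply/funext => j; case: ifP => // _; rewrite IH.
Qed.

Lemma subst_comp (sigma tau : V -> term F V) t :
  subst tau (subst sigma t) = subst (fun x => subst tau (sigma x)) t.
Proof. by elim: t => //= f ts IH; congr Fun; apply/funext. Qed.

Lemma subst_Var t : subst (@Var F V) t = t.
Proof. by elim: t => //= f ts IH; congr Fun; apply/funext. Qed.

Lemma subst_ground (sigma : V -> term F V) t : ground t -> subst sigma t = t.
Proof.
elim: t => //= f ts IH gr; congr Fun; apply/funext => i; exact: IH.
Qed.

Lemma rewrites_fill X C s t : rewrites X s t -> rewrites X (fill C s) (fill C t).
Proof.
move=> [D [sigma [l [r [Xlr -> ->]]]]].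
by exists (comp_ctx C D), sigma, l, r; rewrite !fill_comp.
Qed.

Lemma rewrites_subst X (tau : V -> term F V) s t :
  rewrites X s t -> rewrites X (subst tau s) (subst tau t).
Proof.
move=> [D [sigma [l [r [Xlr -> ->]]]]]; have [D' eD] := subst_fill tau D.
exists D', (fun x => subst tau (sigma x)), l, r; split=> //.
  by rewrite eD subst_comp.
by rewrite eD subst_comp.
Qed.

Lemma rewrites_rule X s t : X (s, t) -> rewrites X s t.
Proof. by move=> Xst; exists (Hole F V), (@Var F V), s, t; rewrite /= !subst_Var. Qed.

Lemma rewrites_sub X Y s t : X `<=` Y -> rewrites X s t -> rewrites Y s t.
Proof.
move=> XY [C [sigma [l [r [/XY Ylr -> ->]]]]].
by exists C, sigma, l, r.
Qed.

Lemma ground_rewritesP X s t : ground_pairs X ->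
  rewrites X s t <->
  exists C l r, [/\ X (l, r), s = fill C l & t = fill C r].
Proof.
move=> grX; split=> [[C [sigma [l [r [Xlr -> ->]]]]]|[C [l [r [Xlr -> ->]]]]].
  by have [grl grr] := grX _ _ Xlr; exists C, l, r; rewrite !subst_ground.
by apply: rewrites_fill; apply: rewrites_rule.
Qed.

Lemma conversion_fill X C s t :
  conversion X s t -> conversion X (fill C s) (fill C t).
Proof.
elim=> [x y xy|x|x y _|x y z _ xy _ yz].
- by apply: rst_step; apply: rewrites_fill.
- exact: rst_refl.
- exact: rst_sym.
- exact: rst_trans xy yz.
Qed.

Lemma conversion_subst X (tau : V -> term F V) s t :
  conversion X s t -> conversion X (subst tau s) (subst tau t).
Proof.
elim=> [x y xy|x|x y _|x y z _ xy _ yz].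
- by apply: rst_step; apply: rewrites_subst.
- exact: rst_refl.
- exact: rst_sym.
- exact: rst_trans xy yz.
Qed.

Lemma conversion_mono X Y :
  (forall s t, X (s, t) -> conversion Y s t) ->
  forall s t, conversion X s t -> conversion Y s t.
Proof.
move=> XY s t; elim=> [x y|x|x y _|x y z _ xy _ yz].
- move=> [C [sigma [l [r [Xlr -> ->]]]]].
  by apply: conversion_fill; apply: conversion_subst; apply: XY.
- exact: rst_refl.
- exact: rst_sym.
- exact: rst_trans xy yz.
Qed.

Lemma conversion_rule X s t : X (s, t) -> conversion X s t.
Proof. by move=> /rewrites_rule; apply: rst_step. Qed.

(** The arguments are replaced one at a time; in [mix e] those at the positions in [e] have been
    replaced. *)
Lemma fill_closed_Fun (Q : relation (term F V)) :
  (forall t, Q t t) -> (forall s t u, Q s t -> Q t u -> Q s u) ->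
  (forall C s t, Q s t -> Q (fill C s) (fill C t)) ->
  forall (f : F) (ts us : 'I_(arity f) -> term F V),
    (forall i, Q (ts i) (us i)) -> Q (Fun ts) (Fun us).
Proof.
move=> Qrefl Qtrans Qfill f ts us Qtu.
pose mix (e : seq 'I_(arity f)) := fun j => if j \in e then us j else ts j.
suff Qmix e : Q (Fun ts) (Fun (mix e)).
  by have := Qmix (enum 'I_(arity f)); congr Q; congr Fun; apply/funext => j;
     rewrite /mix mem_enum.
elim: e => [|i e IH].
  by have -> : mix [::] = ts by apply/funext.
apply: Qtrans IH _.
have -> : Fun (mix e) = fill (CFun i (mix e) (Hole F V)) (mix e i).
  by congr Fun; apply/funext => j; case: eqP => [->|].
have -> : Fun (mix (i :: e)) = fill (CFun i (mix e) (Hole F V)) (us i).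
  by congr Fun; apply/funext => j; rewrite /mix inE; case: eqP => [->|].
apply: (Qfill (CFun i (mix e) (Hole F V))).
by rewrite /mix; case: ifP.
Qed.

Lemma rewrites_star_fill X C s t :
  clos_refl_trans _ (rewrites X) s t ->
  clos_refl_trans _ (rewrites X) (fill C s) (fill C t).
Proof.
elim=> [x y xy|x|x y z _ xy _ yz].
- by apply: rt_step; apply: rewrites_fill.
- exact: rt_refl.
- exact: rt_trans xy yz.
Qed.

Lemma NF_star X s t : NF X s -> clos_refl_trans _ (rewrites X) s t -> s = t.
Proof.
move=> NFs st; case: (clos_rt_rt1n _ _ _ _ st) NFs => // u v su _ [].
by exists u.
Qed.

Lemma NF_fill X C s : NF X (fill C s) -> NF X s.
Proof. by move=> NFs [t st]; apply: NFs; exists (fill C t); apply: rewrites_fill. Qed.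

Lemma NF_arg X (f : F) (ts : 'I_(arity f) -> term F V) i :
  NF X (Fun ts) -> NF X (ts i).
Proof.
move=> NFt; apply: (@NF_fill X (CFun i ts (Hole F V))) => /=.
by congr (NF X (Fun _)): NFt; apply/funext => j; case: eqP => [->|].
Qed.

End Terms.

(** * Injective monotone encoding of ground terms into the natural numbers *)

Section Weight.

(** The code of [n :: s] is [2 ^ n * (2 * code s + 1)], which is strictly increasing in both [n] and
    [code s]. *)
Lemma leq_ltn_code (T : eqType) (a b : T -> nat) (e : seq T) (i : T) :
  (forall j, a j <= b j) -> i \in e -> a i < b i ->
  CodeSeq.code (map a e) < CodeSeq.code (map b e).
Proof.
move=> leab + ltab; have leq_code e' : CodeSeq.code (map a e') <= CodeSeq.code (map b e').
  elim: e' => //= j e' IH; apply: leq_mul; first by rewrite leq_exp2l.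
  by rewrite ltnS leq_double.
elim: e => //= j e IH; rewrite inE => /predU1P [<-|ie].
  apply: (@leq_ltn_trans (2 ^ a i * (CodeSeq.code (map b e)).*2.+1)).
    by rewrite leq_mul2l ltnS leq_double leq_code orbT.
  by rewrite ltn_pmul2r // ltn_exp2l.
apply: (@leq_trans (2 ^ a j * (CodeSeq.code (map b e)).*2.+1)).
  by rewrite ltn_pmul2l ?expn_gt0 // ltnS ltn_double IH.
by apply: leq_mul => //; rewrite leq_exp2l.
Qed.

Variables (F : signature) (V : Type) (idx : F -> nat).

Fixpoint weight (t : term F V) : nat :=
  match t with
  | Var _ => 0
  | Fun f ts =>
      CodeSeq.code (idx f :: [seq weight (ts i) | i <- enum 'I_(arity f)])
  end.

Lemma weight_fill C s t : weight s < weight t ->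
  weight (fill C s) < weight (fill C t).
Proof.
move=> lt_st; elim: C => //= f i ts C IH.
rewrite ltn_pmul2l ?expn_gt0 // ltnS ltn_double.
apply: (@leq_ltn_code _ _ _ _ i); rewrite ?mem_enum ?eqxx // => j.
by case: ifP => // _; exact: ltnW.
Qed.

Lemma weight_arg (f : F) (ts : 'I_(arity f) -> term F V) i :
  weight (ts i) < weight (Fun ts).
Proof.
have /allP := CodeSeq.ltn_code (idx f :: [seq weight (ts i) | i <- enum 'I_(arity f)]).
apply; rewrite inE; apply/orP; right.
by apply: (map_f (fun i => weight (ts i))); rewrite mem_enum.
Qed.

Lemma weight_fill_ge C t : weight t <= weight (fill C t).
Proof.
elim: C => // f i ts C IH; apply: (leq_trans IH); apply: ltnW.
have := weight_arg (fun j => if j == i then fill C t else ts j) i.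
by rewrite eqxx.
Qed.

(** The restriction to [G] allows [idx] to be injective on [G] only, as [F] may be uncountable. *)
Fixpoint ground_over (G : set F) (t : term F V) : Prop :=
  match t with
  | Var _ => False
  | Fun f ts => G f /\ forall i, ground_over G (ts i)
  end.

Lemma ground_overW G t : ground_over G t -> ground t.
Proof. by elim: t => //= f ts IH [_ gr] i; apply: IH. Qed.

Lemma ground_over_fill G C s t : ground_over G (fill C s) ->
  ground_over G t -> ground_over G s /\ ground_over G (fill C t).
Proof.
elim: C => //= f i ts C IH [Gf gr] grt.
have grCs : ground_over G (fill C s) by have := gr i; rewrite eqxx.
have [grs grCt] := IH grCs grt; split=> //; split=> // j.
by case: eqP (gr j).
Qed.

(** [CodeSeq.code] can be decoded, so equal weights force equal root indices and equal weights of
    the arguments. *)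
Lemma weight_inj G s t : {in G &, injective idx} ->
  ground_over G s -> ground_over G t -> weight s = weight t -> s = t.
Proof.
move=> idx_inj; elim: s t => // f ts IH [//|g us] /= [Gf grs] [Gg grt].
move=> /(can_inj CodeSeq.codeK (x1 := _ :: _) (x2 := _ :: _)) [].
move=> /(idx_inj _ _ (mem_set Gf) (mem_set Gg)) efg.
case: _ / efg us Gg grt => us _ grt /eq_in_map eus.
congr Fun; apply/funext => i; apply: IH => //.
by apply: eus; rewrite mem_enum.
Qed.

End Weight.

(** Classical structures on terms: [xget] needs a choice type, and membership in sequences an
    equality type. *)
HB.instance Definition _ (F : signature) (V : Type) := gen_eqMixin (term F V).
HB.instance Definition _ (F : signature) (V : Type) := gen_choiceMixin (term F V).

(** * Innermost normalization in a reduced ground system *)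

Section InnermostNormalization.
Variables (F : signature) (V : Type) (X : pairs F V).
Implicit Types (s t u l r : term F V).

(** [xget] falls back to [t] itself when no rule has left-hand side [t]. *)
Definition contract t := xget t [set r | X (t, r)].

(** Once the arguments are normal, a single contraction at the root is enough for a reduced ground
    system: it yields a right-hand side, which is already normal. *)
Fixpoint nf t : term F V :=
  match t with
  | Var x => Var F x
  | Fun f ts => contract (Fun (fun i => nf (ts i)))
  end.

Definition redex t : bool := `[< exists r, X (t, r) >].

(* The number of steps of the innermost reduction to normal form. *)
Fixpoint cost t : nat :=
  match t with
  | Var _ => 0
  | Fun f ts => \sum_(i < arity f) cost (ts i) + redex (Fun (fun i => nf (ts i)))
  end.

Hypotheses (grX : ground_pairs X) (redX : reduced X).

Lemma reduced_rhs l r : X (l, r) -> NF X r.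
Proof. by move=> /redX []. Qed.

Lemma reduced_functional l r r' : X (l, r) -> X (l, r') -> r = r'.
Proof.
move=> Xlr Xlr'; apply: contrapT => neq; have [NFl _] := redX Xlr.
by apply: NFl; exists r'; apply: rewrites_rule; split=> //= -[/esym].
Qed.

Lemma contract_rule l r : X (l, r) -> contract l = r.
Proof.
move=> Xlr; apply: xget_unique => // r' Xlr'; exact: reduced_functional Xlr' Xlr.
Qed.

(** A redex inside an argument is a proper subterm of the left-hand side, so it comes from another
    rule, against reducedness. *)
Lemma reduced_lhs_arg (f : F) (ts : 'I_(arity f) -> term F V) r i :
  X (Fun ts, r) -> NF X (ts i).
Proof.
move=> Xr [t /(ground_rewritesP _ _ grX) [C [l' [r' [Xr' eti _]]]]].
have [NFl _] := redX Xr; apply: NFl.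
exists (fill (CFun i ts C) r').
have eFun : Fun ts = fill (CFun i ts C) l'.
  by rewrite /= -eti; congr Fun; apply/funext => j; case: eqP => [->|].
rewrite [X in rewrites _ X _]eFun.
apply: rewrites_fill; apply: rewrites_rule; split=> //= -[el' _].
(* With a constant index, [weight] serves merely as a size: no term occurs inside one of its own
   arguments. *)
have := weight_arg (fun=> 0) ts i.
by rewrite ltnNge eti el' weight_fill_ge.
Qed.

Lemma nf_star t : clos_refl_trans _ (rewrites X) t (nf t).
Proof.
elim: t => [x|f ts IH] /=; first exact: rt_refl.
apply: (@rt_trans _ _ _ (Fun (fun i => nf (ts i)))).
  apply: (@fill_closed_Fun _ _ (clos_refl_trans _ (rewrites X))) => //.
  - exact: rt_refl.
  - exact: rt_trans.
  - exact: rewrites_star_fill.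
rewrite /contract; case: xgetP => [r _ Xr|_]; last exact: rt_refl.
by apply: rt_step; apply: rewrites_rule.
Qed.

Lemma nf_NF t : NF X (nf t).
Proof.
elim: t => [x|f ts IH] /=.
  move=> [t /(ground_rewritesP _ _ grX) [[|f i ts C] [l [r [Xlr //= xl _]]]]].
  by have [] := grX Xlr; rewrite -xl.
rewrite /contract; case: xgetP => [r _ /reduced_rhs //|NX].
move=> [t /(ground_rewritesP _ _ grX) [[|g i us C] [l [r [Xlr /= xl _]]]]].
  by apply: (NX r); rewrite /= xl.
case: xl => efg; case: _ / efg i us => i us eus.
apply: (IH i); exists (fill C r).
have -> : nf (ts i) = fill C l.
  by rewrite (congr1 (fun h => h i) (inj_pair2 _ _ _ _ _ eus)) eqxx.
by apply: rewrites_fill; apply: rewrites_rule.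
Qed.

Lemma nf_id t : NF X t -> nf t = t.
Proof. by move=> NFt; apply/esym/(NF_star NFt)/nf_star. Qed.

Lemma nf_args (f : F) (ts : 'I_(arity f) -> term F V) :
  (forall i, NF X (ts i)) -> (fun i => nf (ts i)) = ts.
Proof. by move=> NFts; apply/funext => i; apply: nf_id. Qed.

Lemma nf_lhs l r : X (l, r) -> nf l = r.
Proof.
case: l => [x|f ts] Xlr; first by have [] := grX Xlr.
rewrite /= nf_args ?(contract_rule Xlr) // => i; exact: reduced_lhs_arg Xlr.
Qed.

Lemma nf_fill C s t : nf s = nf t -> nf (fill C s) = nf (fill C t).
Proof.
move=> est; elim: C => //= f i ts C IH; congr (contract (Fun _)).
by apply/funext => j; case: ifP.
Qed.

(** Both sides of a rule have the same [nf], and this equality propagates through contexts;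
    conversely each term converts to its [nf]. *)
Lemma nf_conversion s t : conversion X s t <-> nf s = nf t.
Proof.
split=> [|est].
  elim=> [x y /(ground_rewritesP _ _ grX)|//|//|x y z _ -> _ -> //].
  move=> [C [l [r [Xlr -> ->]]]].
  by apply: nf_fill; rewrite (nf_lhs Xlr) nf_id //; apply: reduced_rhs Xlr.
have convnf u : conversion X u (nf u) by apply: clos_rt_clos_rst; apply: nf_star.
by apply: rst_trans (convnf s) _; rewrite est; apply: rst_sym; apply: convnf.
Qed.

Lemma NF_cost t : NF X t -> cost t = 0.
Proof.
elim: t => //= f ts IH NFt; rewrite big1 => [|i _]; last first.
  by apply: IH; apply: NF_arg NFt.
rewrite add0n nf_args => [|i]; last exact: NF_arg NFt.
apply/eqP; rewrite eqb0; apply/asboolPn => -[r Xr].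
by apply: NFt; exists r; apply: rewrites_rule.
Qed.

(** The arguments of a left-hand side are normal, so innermost reduction contracts it at the
    root. *)
Lemma cost_lhs l r : X (l, r) -> 0 < cost l.
Proof.
case: l => [x|f ts] Xlr; first by have [] := grX Xlr.
rewrite /= (_ : redex _ = true) ?addn1 //; apply/asboolP; exists r.
by rewrite nf_args // => i; apply: reduced_lhs_arg Xlr.
Qed.

End InnermostNormalization.

(** * Reduced systems oriented by a common reduction order *)

Section ReductionOrders.
Variables (F : signature) (V : Type) (gt : relation (term F V)).
Hypothesis gtP : reduction_order gt.

Lemma rewrites_gt (X : pairs F V) s t :
  (forall l r, X (l, r) -> gt l r) -> rewrites X s t -> gt s t.
Proof.
move=> Xgt [C [sigma [l [r [/Xgt lr -> ->]]]]].
by apply: (ro_ctx gtP); apply: (ro_subst gtP).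
Qed.

Lemma rewrites_star_gt (X : pairs F V) s t :
  (forall l r, X (l, r) -> gt l r) ->
  clos_refl_trans _ (rewrites X) s t -> s = t \/ gt s t.
Proof.
move=> Xgt; elim=> [x y /(rewrites_gt Xgt)|x|x y z _ xy _ yz]; [by right|by left|].
case: xy yz => [->//|xy] [<-|yz]; right=> //; exact: ro_trans gtP _ _ _ xy yz.
Qed.

(** Otherwise [t > C[t] > C[C[t]] > ...] would descend forever. *)
Lemma not_gt_fill C t : ~ gt t (fill C t).
Proof.
elim/(well_founded_ind (ro_wf gtP)): t => t IH gt_t.
exact: IH gt_t (ro_ctx gtP C gt_t).
Qed.

(* The X-normal form of t reduces to its Y-normal form and vice versa; as both
   systems decrease gt, the two coincide. *)
Lemma reduced_sub (X Y : pairs F V) :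
  ground_pairs X -> ground_pairs Y -> reduced X -> reduced Y ->
  (forall l r, X (l, r) -> gt l r) -> (forall l r, Y (l, r) -> gt l r) ->
  equivalent X Y -> X `<=` Y.
Proof.
move=> grX grY redX redY Xgt Ygt eqv.
have convX t : conversion X t (nf X t) by apply/clos_rt_clos_rst/nf_star.
have convY t : conversion Y t (nf Y t) by apply/clos_rt_clos_rst/nf_star.
have nfXY t : nf X t = nf Y t.
  have := rewrites_star_gt Xgt (nf_star X (nf Y t)).
  have -> : nf X (nf Y t) = nf X t.
    by apply/esym/(nf_conversion grX redX)/eqv.
  have := rewrites_star_gt Ygt (nf_star Y (nf X t)).
  have -> : nf Y (nf X t) = nf Y t.
    by apply/esym/(nf_conversion grY redY)/eqv.
  move=> [//|XY] [//|YX]; case: (ro_irrefl gtP (ro_trans gtP XY YX)).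
have NFXY t : NF Y t -> NF X t.
  by move=> /nf_id <-; rewrite -nfXY; apply: nf_NF.
move=> [l r] Xlr.
(* As [l] is not [X]-normal, it is not [Y]-normal either, so some rule of [Y] applies to it. *)
have [|NFl] := pselect (exists t, rewrites Y l t); last first.
  by have := NFXY _ NFl; case; exists r; apply: rewrites_rule.
move=> [t /(ground_rewritesP _ _ grY) [C [l' [r' [Ylr' el _]]]]].
(* At the root, both right-hand sides are the common normal form of [l]. Below the root, the rule
   would reduce an argument of [l], which is [X]-normal and therefore [Y]-normal. *)
case: C el => [|f i ts C] /= el.
  have err' : r = r'.
    by rewrite -(nf_lhs grX redX Xlr) -(nf_lhs grY redY Ylr') nfXY el.
  by rewrite el err'.
have : NF Y (fill C l').
  rewrite el in Xlr; have := reduced_lhs_arg (i := i) grX redX Xlr.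
  rewrite eqxx => /nf_id <-.
  by rewrite nfXY; apply: nf_NF.
by case; exists (fill C r'); apply: rewrites_fill; apply: rewrites_rule.
Qed.

End ReductionOrders.

(** * The reduction order used for completion *)

Section CompletionOrder.
Variables (F : signature) (V : Type) (X : pairs F V) (idx : F -> nat).
Hypotheses (grX : ground_pairs X) (redX : reduced X).

Definition rank (t : term F V) : nat * nat := (cost X t, weight idx t).

Definition ground_gt (s t : term F V) : Prop :=
  nf X s = nf X t /\ ltlex (rank t) (rank s).

(* [ground_gt] treats variables as constants; quantifying over all instances
   makes the order closed under substitutions. *)
Definition completion_gt (s t : term F V) : Prop :=
  forall sigma : V -> term F V, ground_gt (subst sigma s) (subst sigma t).

(** Around the hole both terms have the same redexes, since their arguments have equal normal forms.
    The equation is additive to avoid truncated subtraction. *)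
Lemma cost_fill C s t : nf X s = nf X t ->
  cost X (fill C s) + cost X t = cost X (fill C t) + cost X s.
Proof.
move=> est; elim: C => [|f i ts C IH] /=; first exact: addnC.
have -> : (fun j => nf X (if j == i then fill C s else ts j))
        = (fun j => nf X (if j == i then fill C t else ts j)).
  by apply/funext => j; case: ifP => // _; apply: nf_fill.
rewrite (bigD1 i) //= [in RHS](bigD1 i) //= !eqxx.
rewrite (eq_bigr (fun j => cost X (ts j))) => [|j /negPf -> //].
rewrite [in RHS](eq_bigr (fun j => cost X (ts j))) => [|j /negPf -> //].
lia.
Qed.

Lemma ground_gt_fill C s t : ground_gt s t -> ground_gt (fill C s) (fill C t).
Proof.
move=> [est lt_st]; split; first exact: nf_fill.
have := cost_fill C est; case: lt_st; rewrite /ltlex /rank /=; first by lia.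
by move=> [? /(weight_fill C)]; lia.
Qed.

Lemma completion_gt_ground_gt s t : completion_gt s t -> ground_gt s t.
Proof. by move=> /(_ (@Var F V)); rewrite !subst_Var. Qed.

Lemma ground_gt_completion_gt s t :
  ground s -> ground t -> ground_gt s t -> completion_gt s t.
Proof. by move=> grs grt gt_st sigma; rewrite !subst_ground. Qed.

Lemma completion_gt_reduction_order : reduction_order completion_gt.
Proof.
split=> [s|s t u|||].
- by move=> /completion_gt_ground_gt [_ /ltlex_irrefl].
- move=> st tu sigma; have [est lts] := st sigma; have [etu ltu] := tu sigma.
  by split; [rewrite est|apply: ltlex_trans lts].
- apply: (wf_incl _ _ (fun s t => ltlex (rank s) (rank t))).
    by move=> s t /completion_gt_ground_gt [].
  exact/wf_inverse_image/ltlex_wf.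
- move=> C s t st sigma; have [D eD] := subst_fill sigma C.
  by rewrite !eD; apply: ground_gt_fill.
- by move=> tau s t st sigma; rewrite !subst_comp.
Qed.

Lemma rule_completion_gt l r : X (l, r) -> completion_gt l r.
Proof.
move=> Xlr; have [grl grr] := grX Xlr; apply: ground_gt_completion_gt => //.
have NFr := reduced_rhs redX Xlr.
split; first by rewrite (nf_lhs grX redX Xlr) (nf_id NFr).
by left; rewrite /= (NF_cost NFr); exact: cost_lhs Xlr.
Qed.

(** Distinct ground terms over [G] have distinct weights, hence distinct ranks, and substitutions
    leave them unchanged. *)
Lemma completion_gt_total G s t : {in G &, injective idx} ->
  ground_over G s -> ground_over G t -> nf X s = nf X t -> s <> t ->
  completion_gt s t \/ completion_gt t s.
Proof.
move=> idx_inj grs grt est neq.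
have grs' := ground_overW grs; have grt' := ground_overW grt.
have /ltlex_total [lt|lt] : rank t <> rank s.
- by move=> [_ /(weight_inj idx_inj grt grs) ets]; apply: neq.
- by left; apply: ground_gt_completion_gt.
- by right; apply: ground_gt_completion_gt.
Qed.

End CompletionOrder.

(** * Finite sets of pairs as sequences *)

Section FinitePairs.
Variables (F : signature) (V : Type) (h : term F V -> nat).
Implicit Types (e : seq (term F V * term F V)) (p : term F V * term F V).

(** All occurrences are removed, so that [p] is absent from the rest, as the disjoint unions of
    [KBg] demand. *)
Definition rem_all p e : seq (term F V * term F V) := filter (predC1 p) e.

Lemma set_seq_cons p e : [set` p :: e] = [set` e] `|` [set p].
Proof.
apply/seteqP; split=> q /=; rewrite inE; first by case/predU1P; [right|left].
by move=> [->|->]; rewrite ?eqxx ?orbT.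
Qed.

Lemma mem_rem_all p e q : (q \in rem_all p e) = (q != p) && (q \in e).
Proof. by rewrite mem_filter. Qed.

Lemma set_seq_rem_all p e : p \in e -> [set` e] = [set` rem_all p e] `|` [set p].
Proof.
move=> pe; apply/seteqP; split=> q /=; rewrite mem_rem_all.
  by move=> ->; have [->|] := eqVneq q p; [right|left].
by move=> [/andP [_ //]|->].
Qed.

Lemma notin_rem_all p e : ~ [set` rem_all p e] p.
Proof. by rewrite /= mem_rem_all eqxx. Qed.

Lemma size_rem_all p e : p \in e -> size (rem_all p e) < size e.
Proof.
move=> pe; rewrite size_filter -(count_predC (pred1 p) e) -[X in X < _]add0n.
by rewrite ltn_add2r -has_count has_pred1.
Qed.

Definition pair_sum e : nat := \sum_(p <- e) (h p.1 + h p.2).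

Lemma pair_sum_cons s t e : pair_sum ((s, t) :: e) = h s + h t + pair_sum e.
Proof. exact: big_cons. Qed.

(** Only an inequality, since [p] may occur several times in [e]. *)
Lemma pair_sum_rem_all p e : p \in e ->
  pair_sum (rem_all p e) + (h p.1 + h p.2) <= pair_sum e.
Proof.
move=> pe; rewrite /pair_sum big_filter [leqRHS](bigID (predC1 p)) leq_add2l.
by rewrite (big_rem p) //= eqxx leq_addr.
Qed.

End FinitePairs.

(** * Completion with a decreasing measure *)

Section Completion.
Variables (F : signature) (V : Type) (E X : pairs F V) (idx : F -> nat) (G : set F).
Hypothesis idx_inj : {in G &, injective idx}.
Implicit Types (e es rs : seq (term F V * term F V)) (p q : term F V * term F V).

Local Notation gt := (completion_gt X idx).
Let gtP : reduction_order gt := completion_gt_reduction_order X idx.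

(** Admissible pairs with distinct sides are comparable by [gt]. *)
Definition admissible p : Prop :=
  [/\ ground_over G p.1, ground_over G p.2 & nf X p.1 = nf X p.2].

(** Admissible pairs are [X]-convertible, and [inv_complete] retains the conversions of [E]; so if
    [E] and [X] are equivalent, the current pairs are equivalent to both. *)
Record completion_inv es rs : Prop := CompletionInv {
  inv_admissible : forall p, p \in es ++ rs -> admissible p;
  inv_oriented : forall p, p \in rs -> gt p.1 p.2;
  inv_complete : forall s t, E (s, t) -> conversion [set` es ++ rs] s t
}.

Lemma completion_inv_step es rs es' rs' : completion_inv es rs ->
  (forall p, p \in es' ++ rs' -> p \in es ++ rs \/ admissible p) ->
  (forall p, p \in rs' -> p \in rs \/ gt p.1 p.2) ->
  (forall s t, (s, t) \in es ++ rs -> conversion [set` es' ++ rs'] s t) ->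
  completion_inv es' rs'.
Proof.
move=> [adm ori compl] adm' ori' compl'; split.
- by move=> p /adm' [/adm|].
- by move=> p /ori' [/ori|].
- by move=> s t /compl; apply: conversion_mono => l r; apply: compl'.
Qed.

(* Equations weigh 1 more than rules, so that [orient] decreases the measure;
   the factor 2 compensates for this in [collapse]. *)
Definition measure es rs : nat * nat :=
  (pair_sum (cost X) es + pair_sum (cost X) rs,
   2 * (pair_sum (weight idx) es + pair_sum (weight idx) rs) + size es).

(** [e] will be all of [rs] when a right-hand side is reduced, and [rs] without the rule in question
    when a left-hand side is. *)
Lemma inv_rewrites es rs e s t : completion_inv es rs -> {subset e <= rs} ->
  ground_over G s -> rewrites [set` e] s t ->
  [/\ ground_over G t, nf X s = nf X t & gt s t].
Proof.
move=> [adm ori _] sub grs st.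
have gt_st : gt s t by apply: rewrites_gt st => // l r /sub /ori.
have [est _] := completion_gt_ground_gt gt_st; split=> //.
have gre : ground_pairs [set` e].
  move=> l r /sub lr; have [|grl grr _] := adm (l, r); first by rewrite mem_cat lr orbT.
  by split; [exact: ground_overW grl|exact: ground_overW grr].
have [C [l [r [/sub lr es0 ->]]]] := (ground_rewritesP _ _ gre).1 st.
have [|_ grr _] := adm (l, r); first by rewrite mem_cat lr orbT.
rewrite es0 in grs; exact: (ground_over_fill grs grr).2.
Qed.

(** A trivial equation is deleted; any other one is oriented, as its sides are comparable. *)
Lemma equation_step es rs p : completion_inv es rs -> p \in es ->
  exists es' rs', [/\ KBg gt ([set` es], [set` rs]) ([set` es'], [set` rs']),
    completion_inv es' rs' & ltlex (measure es' rs') (measure es rs)].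
Proof.
case: p => s t inv pe; have adm : (s, t) \in es ++ rs by rewrite mem_cat pe.
have {}adm := inv_admissible inv adm.
have [grs grt est] := adm; rewrite /= in grs grt est.
have size_lt := size_rem_all pe.
have /= cost_le := pair_sum_rem_all (cost X) pe.
have /= weight_le := pair_sum_rem_all (weight idx) pe.
have sub p : p \in rem_all (s, t) es -> p \in es by rewrite mem_rem_all => /andP [].
have keep l r : (l, r) \in es ++ rs ->
    (l, r) = (s, t) \/ (l, r) \in rem_all (s, t) es ++ rs.
  rewrite !mem_cat mem_rem_all; have [->|] := eqVneq (l, r) (s, t); first by left.
  by right.
(* Both orientations at once: the cost and weight sums do not grow, and [size es] drops. *)
have orient q : q = (s, t) \/ q = (t, s) -> gt q.1 q.2 ->
    completion_inv (rem_all (s, t) es) (q :: rs) /\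
    ltlex (measure (rem_all (s, t) es) (q :: rs)) (measure es rs).
  move=> qst gtq; split.
    apply: completion_inv_step inv _ _ _.
    - move=> p; rewrite mem_cat inE => /or3P [/sub pe'|/eqP ->|pr].
      + by left; rewrite mem_cat pe'.
      + by right; case: qst => ->.
      + by left; rewrite mem_cat pr orbT.
    - by move=> p; rewrite inE => /predU1P [->|]; [right|left].
    - have conv_q : conversion [set` rem_all (s, t) es ++ q :: rs] q.1 q.2.
        case: q {qst gtq} => l r; apply: conversion_rule.
        by rewrite /= mem_cat inE eqxx orbT.
      move=> l r /keep [[-> ->]|lr].
        by case: qst conv_q => -> //=; apply: rst_sym.
      apply: conversion_rule; move: lr; rewrite /= !mem_cat inE.
      by case/orP => ->; rewrite ?orbT.
  by rewrite /ltlex /measure /=; case: qst => ->; rewrite !pair_sum_cons; lia.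
have [eq_st|neq_st] := pselect (s = t).
  exists (rem_all (s, t) es), rs; split.
  - rewrite (set_seq_rem_all pe) -eq_st; apply: delete.
    exact: notin_rem_all.
  - apply: completion_inv_step inv _ _ _ => [p||l r /keep [[-> ->]|lr]].
    + by rewrite !mem_cat => /orP [/sub ->|->]; left; rewrite ?orbT.
    + by left.
    + by rewrite eq_st; apply: rst_refl.
    + exact: conversion_rule.
  - by rewrite /ltlex /measure /=; lia.
have [gt_st|gt_ts] := completion_gt_total idx_inj grs grt est neq_st.
  have [|inv' lt'] := orient (s, t) _ gt_st; first by left.
  exists (rem_all (s, t) es), ((s, t) :: rs); split=> //.
  rewrite (set_seq_rem_all pe) set_seq_cons; apply: orient_lr gt_st.
  exact: notin_rem_all.
have [|inv' lt'] := orient (t, s) _ gt_ts; first by right.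
exists (rem_all (s, t) es), ((t, s) :: rs); split=> //.
rewrite (set_seq_rem_all pe) set_seq_cons; apply: orient_rl gt_ts.
exact: notin_rem_all.
Qed.

(** If reducedness fails at [l -> r], then either the other rules reduce [l] and [collapse] applies,
    or [r] is reducible and [compose] applies. *)
Lemma rule_step rs : completion_inv [::] rs -> ~ reduced [set` rs] ->
  exists es' rs', [/\ KBg gt ([set` [::]], [set` rs]) ([set` es'], [set` rs']),
    completion_inv es' rs' & ltlex (measure es' rs') (measure [::] rs)].
Proof.
move=> inv; move=> /existsNP [l /existsNP [r /not_implyP [/= lr nred]]].
have [grl grr elr] := inv_admissible inv lr; rewrite /= in grl grr elr.
have gt_lr := inv_oriented inv lr; rewrite /= in gt_lr.
have /= cost_le := pair_sum_rem_all (cost X) lr.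
have /= weight_le := pair_sum_rem_all (weight idx) lr.
have sub p : p \in rem_all (l, r) rs -> p \in rs by rewrite mem_rem_all => /andP [].
have set_rem : [set` rs] `\` [set (l, r)] = [set` rem_all (l, r) rs].
  apply/seteqP; split=> p /=; rewrite mem_rem_all.
    by move=> [-> /eqP ->].
  by move=> /andP [/eqP].
have keep p : p \in rs -> p = (l, r) \/ p \in rem_all (l, r) rs.
  by rewrite mem_rem_all; have [|_ ->] := eqVneq p (l, r); [left|right].
have [[u lu]|NFl] := pselect (exists u, rewrites [set` rem_all (l, r) rs] l u).
  have [gru elu gt_lu] := inv_rewrites inv sub grl lu.
  exists [:: (u, r)], (rem_all (l, r) rs); split.
  - rewrite (set_seq_rem_all lr) set_seq_cons; apply: collapse lu.
    exact: notin_rem_all.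
  - apply: completion_inv_step inv _ _ _ => [p||s t /keep [[-> ->]|st]].
    + rewrite inE => /predU1P [->|/sub]; last by left.
      by right; split; rewrite //= -elu.
    + by move=> p /sub; left.
    (* The old rule is recovered by reducing [l] to [u] and then using the new equation. *)
    + apply: (@rst_trans _ _ _ u).
        apply: rst_step; apply: rewrites_sub lu => p /= pr.
        by rewrite inE pr orbT.
      by apply: conversion_rule; rewrite /= inE eqxx.
    + by apply: conversion_rule; rewrite /= inE st orbT.
  - have [_] := completion_gt_ground_gt gt_lu.
    by rewrite /ltlex /measure /= !pair_sum_cons; lia.
have [[u ru]|NFr] := pselect (exists u, rewrites [set` rs] r u); last first.
  by case: nred; rewrite set_rem.
have [gru eru gt_ru] := inv_rewrites inv (fun p => id) grr ru.
(* [compose] must not use [l -> r] itself. That rule would give [r = C[l]], but [l > C[l]] is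
   impossible. *)
have ru' : rewrites [set` rem_all (l, r) rs] r u.
  have [C [sigma [l' [r' [lr' er eu]]]]] := ru.
  have [[el' _]|] := keep _ lr'; last by exists C, sigma, l', r'.
  case: (not_gt_fill gtP (C := C) (t := l)).
  have <- : r = fill C l; last exact: gt_lr.
  by rewrite er el' subst_ground //; apply: ground_overW grl.
exists [::], ((l, u) :: rem_all (l, r) rs); split.
- rewrite (set_seq_rem_all lr) set_seq_cons; apply: compose ru'.
  exact: notin_rem_all.
- apply: completion_inv_step inv _ _ _ => [p|p|s t /keep [[-> ->]|st]].
  + rewrite inE => /predU1P [->|/sub]; last by left.
    by right; split; rewrite //= -eru.
  + rewrite inE => /predU1P [->|/sub]; last by left.
    by right; apply: (ro_trans gtP) gt_lr gt_ru.
  (* The old rule is recovered from the new rule [l -> u] and the reversed step from [r] to [u]. *)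
  + apply: (@rst_trans _ _ _ u).
      by apply: conversion_rule; rewrite /= inE eqxx.
    apply: rst_sym; apply: rst_step; apply: rewrites_sub ru' => p /= pr.
    by rewrite inE pr orbT.
  + by apply: conversion_rule; rewrite /= inE st orbT.
- have [_] := completion_gt_ground_gt gt_ru.
  by rewrite /ltlex /measure /= !pair_sum_cons; lia.
Qed.

(** Induction on [measure]: a state without a decreasing step has no equations by [equation_step],
    and then reduced rules by [rule_step]. *)
Lemma completion es rs : completion_inv es rs ->
  exists rs', [/\ KBg_derivation gt ([set` es], [set` rs]) (set0, [set` rs']),
    completion_inv [::] rs' & reduced [set` rs']].
Proof.
have := erefl (measure es rs); move: {2}(measure es rs) => m.
elim/(well_founded_ind ltlex_wf): m es rs => m IH es rs em inv.
have [[es' [rs' [step inv' lt']]]|done] := pselect (exists es' rs',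
    [/\ KBg gt ([set` es], [set` rs]) ([set` es'], [set` rs']),
    completion_inv es' rs' & ltlex (measure es' rs') (measure es rs)]).
  rewrite em in lt'; have [rs'' [der inv'' red'']] := IH _ lt' _ _ erefl inv'.
  by exists rs''; split=> //; apply: rt_trans der; apply: rt_step.
case: es em inv done => [|p es] em inv done; last first.
  by case: done; exact: equation_step inv (mem_head p es).
have set_nil : [set` [::]] = set0 :> pairs F V by apply/seteqP; split.
exists rs; split=> //; first by rewrite set_nil; apply: rt_refl.
by apply: contrapT => nred; apply: done; apply: rule_step.
Qed.

End Completion.

(** * Symbols of the equations and the final derivation *)

Fixpoint symbols (F : signature) (V : Type) (t : term F V) : set F :=
  match t with
  | Var _ => set0
  | Fun f ts => [set f] `|` \bigcup_i symbols (ts i)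
  end.

Lemma countable_symbols (F : signature) (V : Type) (t : term F V) :
  countable (symbols t).
Proof.
elim: t => [x|f ts IH] /=; first exact: countable0.
(* Indexing by [option] turns the set into a single union over a countable type, with [None] for the
   root. *)
have -> : [set f] `|` \bigcup_i symbols (ts i) =
    \bigcup_o (if o is Some i then symbols (ts i) else [set f]).
  apply/seteqP; split=> [g [->|[i _ gi]]|g [[i|] _ gi]].
  - by exists None.
  - by exists (Some i).
  - by right; exists i.
  - by left.
by apply: bigcup_countable => // -[i|].
Qed.

Lemma ground_over_symbols (F : signature) (V : Type) (G : set F) (t : term F V) :
  ground t -> symbols t `<=` G -> ground_over G t.
Proof.
elim: t => //= f ts IH gr subG; split=> [|i]; first by apply: subG; left.
by apply: IH => // g gi; apply: subG; right; exists i.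
Qed.

Theorem theorem5p12 (F : signature) (V : Type) (E R : pairs F V)
  (finE : finite_set E) (groundE : ground_pairs E)
  (groundR : ground_pairs R) (reducedR : reduced R)
  (equivER : equivalent E R) :
  exists gt : relation (term F V),
    reduction_order gt /\ KBg_derivation gt (E, set0) (set0, R).
Proof.
(* Finitely many terms contain countably many symbols, so these can be numbered even if [F] is
   uncountable. *)
pose G := \bigcup_(p in E) (symbols p.1 `|` symbols p.2).
have /countable_injP [idx idx_inj] : countable G.
  apply: bigcup_countable => [|p _]; first exact: finite_set_countable.
  rewrite -bigcup2E; apply: bigcup_countable => // -[|[|n]] _ /=.
  - exact: countable_symbols.
  - exact: countable_symbols.
  - exact: countable0.
have [es eE] := (finite_seqP E).1 finE.
have inv : completion_inv E R idx G es [::].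
  split=> // [[s t]|s t Est]; last first.
    by apply: conversion_rule; rewrite cats0 -eE.
  rewrite cats0 => st; have Est : E (s, t) by rewrite eE.
  have [grs grt] := groundE _ _ Est; split=> /=.
  - by apply: ground_over_symbols => // f fs; exists (s, t) => //; left.
  - by apply: ground_over_symbols => // f ft; exists (s, t) => //; right.
  - by apply/(nf_conversion groundR reducedR)/equivER; apply: conversion_rule.
exists (completion_gt R idx); split; first exact: completion_gt_reduction_order.
have [rs [der [adm ori compl] red]] := completion idx_inj inv.
have grrs : ground_pairs [set` rs].
  move=> l r /adm [grl grr _].
  by split; [exact: ground_overW grl|exact: ground_overW grr].
have equiv : equivalent [set` rs] R.
  move=> s t; split; last by move=> /equivER; apply: conversion_mono.
  apply: conversion_mono => l r /adm [_ _ /= elr].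
  exact/(nf_conversion groundR reducedR).
have gtP := completion_gt_reduction_order R idx.
have Rgt := rule_completion_gt idx groundR reducedR.
have rsgt l r : [set` rs] (l, r) -> completion_gt R idx l r by move=> /ori.
(* Both systems are reduced, equivalent and oriented by the same order, so each contains the
   other. *)
have eR : [set` rs] = R.
  apply/seteqP; split; first exact: (reduced_sub gtP).
  by apply: (reduced_sub gtP) => // s t; split=> /equiv.
have set_nil : [set` [::]] = set0 :> pairs F V by apply/seteqP; split.
by rewrite set_nil -eE eR in der.
Qed.
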